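(* Let $l\in\mathbb{N}$, let $\mathbf{k}=(k_1,\dots,k_l)\in\mathbb{N}^l$ be a strictly increasing sequence, and let $Q^{\mathbf{k}}_n(x,y)$, $0\leqslant n\leqslant k_l+1$, be the polynomials such that $$E_{\mathbf{k}}(z,x,y)=E(z,x,y)\sum_{n=0}^{k_l+1} z^n Q^{\mathbf{k}}_n(x,y)\qquad\text{for all } |z|<1,\ x,y\in\mathbb{C}.$$ Then: (i) For $n=0,1,\dots,k_l+1$, $$Q^{\mathbf{k}}_n(x,y)=Q^{\mathbf{k}}_n(y,x)=Q^{\mathbf{k}}_n(-x,-y)=(-1)^{\kappa+n}Q^{\mathbf{k}}_n(-x,y),$$ where $\kappa:=k_1+k_2+\dots+k_l-l(l+1)/2$. (ii) We have $$Q^{\mathbf{k}}_0(x,y)=(-2)^l\Big[\prod_{j=1}^l k_j\Big]\,H_{\mathbf{k}-1}(x)\,H_{\mathbf{k}-1}(y),$$ where $\mathbf{k}-1:=(k_1-1,\dots,k_l-1)$. (iii) For $n=1,2,\dots,k_l+1$, $$Q^{\mathbf{k}}_n(x,y)=\mathbf{1}_{\{n\notin\mathbf{k}\}}\frac{H_{\mathbf{k},n}(x)H_{\mathbf{k},n}(y)}{2^{n+l}\,n!\,\prod_{j=1}^l(n-k_j)}-\sum_{m=1}^n\frac{H_m(x)H_m(y)}{2^m m!}\,Q^{\mathbf{k}}_{n-m}(x,y),$$ where the first term is $0$ when $n\in\{k_1,\dots,k_l\}$.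
   Context: $\mathbb{N}$ is the set of positive integers. $H_n(x)$ denotes the (physicists') Hermite polynomials, $H_n(x)=(-1)^n e^{x^2}\frac{d^n}{dx^n}e^{-x^2}$. The Wronskian is $\mathrm{Wr}[f_1,\dots,f_m]=\det[\partial_x^{i-1}f_j(x)]_{1\leqslant i,j\leqslant m}$. For $\mathbf{j}=(j_1,\dots,j_m)\in\mathbb{Z}_{\geqslant 0}^m$, $H_{\mathbf{j}}(x):=\mathrm{Wr}[H_{j_1}(x),\dots,H_{j_m}(x)]$. For a strictly increasing sequence $\mathbf{k}=(k_1,\dots,k_l)\in\mathbb{N}^l$ and $n\in\mathbb{Z}_{\geqslant 0}$, $H_{\mathbf{k},n}(x):=\mathrm{Wr}[H_{k_1}(x),\dots,H_{k_l}(x),H_n(x)]$. For $|z|<1$ and $x,y\in\mathbb{C}$, $$E(z,x,y):=\sum_{n\geqslant 0} z^n\frac{H_n(x)H_n(y)}{2^n n!}=\frac{1}{\sqrt{1-z^2}}\exp\Big(\frac{2xyz-z^2(x^2+y^2)}{1-z^2}\Big)$$ (principal branch), and $$E_{\mathbf{k}}(z,x,y):=\sum_{n\in\mathbb{Z}_{\geqslant 0}\setminus\mathbf{k}} z^n\frac{H_{\mathbf{k},n}(x)H_{\mathbf{k},n}(y)}{2^{n+l}\,n!\,\prod_{j=1}^l(n-k_j)},$$ where $\mathbb{Z}_{\geqslant 0}\setminus\mathbf{k}$ means the nonnegative integers different from $k_1,\dots,k_l$; the series converges for all $|z|<1$, $x,y\in\mathbb{C}$. Polynomials $Q^{\mathbf{k}}_n(x,y)$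 with the stated property exist and are unique. *)

(* Defs.v *)
(* The real numbers are an arbitrary R : realType, the complex numbers R[i]. *)
From HB Require Import structures.
From mathcomp Require Import all_boot all_order all_algebra.
From mathcomp Require Import polyXY.
From mathcomp Require Import all_classical all_reals all_analysis.
From mathcomp Require Import complex ring.

Set Implicit Arguments.
Unset Strict Implicit.
Unset Printing Implicit Defensive.

Import Order.TTheory GRing.Theory Num.Theory.
Import numFieldNormedType.Exports.

Local Open Scope classical_set_scope.
Local Open Scope complex_scope.
Local Open Scope ring_scope.

(* Rodrigues' formula, for a real variable x. *)
Definition rodrigues (R : realType) (n : nat) (p : {poly R}) : Prop :=
  forall x : R,
    p.[x] = (-1) ^+ n * expR (x ^+ 2)
            * derive1n n (fun t : R => expR (- (t ^+ 2))) x.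

(* Physicists' Hermite polynomials.  The default value 0 is never used, by
   [hermiteP]; Rodrigues' formula determines p since R is infinite. *)
Definition hermite (R : realType) (n : nat) : {poly R} :=
  xget 0 [set p : {poly R} | rodrigues n p].

Lemma hermiteP (R : realType) (n : nat) : rodrigues n (hermite R n).
Proof.
suff [p pP] : exists p : {poly R}, rodrigues n p.
  exact: (@xgetPex _ 0 [set p : {poly R} | rodrigues n p] (ex_intro _ p pP)).
have e1 (t : R) : expR (- (t ^+ 2)) * expR (t ^+ 2) = 1.
  by rewrite -expRD addNr expR0.
have s1 m : (-1) ^+ m * (-1) ^+ m = 1 :> R by rewrite -exprMn mulrNN mulr1 expr1n.
elim: n => [|n [p pP]].
  by exists 1 => x; rewrite hornerC expr0 mul1r mulrC e1.
exists (2%:R *: ('X * p) - deriv p) => x.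
have dE : derive1n n (fun t : R => expR (- (t ^+ 2))) =
    fun t => (-1) ^+ n * expR (- (t ^+ 2)) * p.[t].
  apply/funext => t; rewrite pP.
  set d := derive1n _ _ _; set a := expR _; set b := expR _.
  have -> : (-1) ^+ n * a * ((-1) ^+ n * b * d) =
      ((-1) ^+ n * (-1) ^+ n) * (a * b) * d by ring.
  by rewrite s1 e1 !mul1r.
have dp : is_derive x 1 (horner p) (deriv p).[x].
  rewrite derivE derive1E.
  by apply: DeriveDef => //; exact: derivable_horner.
have dx2 : is_derive x 1 (fun t : R => - (t ^+ 2)) (- (2%:R * x)).
  by apply: is_derive_eq; rewrite /GRing.scale /= mulr1; ring.
have de : is_derive x 1 (fun t : R => expR (- (t ^+ 2)))
    (- (2%:R * x) * expR (- (x ^+ 2))).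
  rewrite [_ * expR _]mulrC.
  exact: (@is_derive1_comp _ (@expR R) (fun t => - (t ^+ 2))).
rewrite derive1nS dE derive1E.
have -> : (fun t => (-1) ^+ n * expR (- (t ^+ 2)) * p.[t]) =
    (-1) ^+ n *: ((fun t : R => expR (- (t ^+ 2))) * horner p).
  by apply/funext => t; rewrite /= !fctE /GRing.scale /= mulrA.
rewrite derive_val /GRing.scale /= hornerD hornerN hornerZ hornerM hornerX exprS.
set a := expR _ in de *; set b := expR _; set q := (deriv p).[x].
transitivity ((-1) ^+ n * (-1) ^+ n * (a * b) * (2%:R * x * p.[x] - q)); last by ring.
by rewrite s1 e1 !mul1r mulrA.
Qed.

Definition wronskian (F : comNzRingType) (fs : seq {poly F}) : {poly F} :=
  \det (\matrix_(i < size fs, j < size fs) derivn i fs`_j).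

Definition hermiteC (R : realType) (n : nat) : {poly R[i]} :=
  map_poly (real_complex R) (hermite R n).

Definition hermite_wr (R : realType) (js : seq nat) : {poly R[i]} :=
  wronskian [seq hermiteC R n | n <- js].

(* Coefficient of z^n in the expansion of E, i.e. of [mehler] below. *)
Definition mehler_coef (R : realType) (n : nat) (x y : R[i]) : R[i] :=
  (hermiteC R n).[x] * (hermiteC R n).[y] / (2%:R ^+ n * n`!%:R).

(* E(z, x, y), as the sum of its defining series; the limit is taken for the
   topology of the complex modulus, carried by R[i]^o. *)
Definition mehler (R : realType) (z x y : R[i]) : R[i] :=
  limn (series (fun n : nat => z ^+ n * mehler_coef n x y : R[i]^o)).

(* Coefficient of z^n in the expansion of E_k, meaningful for n \notin k only
   (the denominator is 0 otherwise): every use must be guarded. *)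
Definition exc_coef (R : realType) (k : seq nat) (n : nat) (x y : R[i]) : R[i] :=
  (hermite_wr R (rcons k n)).[x] * (hermite_wr R (rcons k n)).[y]
    / (2%:R ^+ (n + size k) * n`!%:R * \prod_(j <- k) (n%:R - j%:R)).

(* E_k(z, x, y). *)
Definition exc_mehler (R : realType) (k : seq nat) (z x y : R[i]) : R[i] :=
  limn (series (fun n : nat =>
    (if n \in k then 0 else z ^+ n * exc_coef k n x y) : R[i]^o)).

(* For k strictly increasing with positive entries, the sum of k is at least
   l(l+1)/2, so the natural-number subtraction does not truncate. *)
Definition kappa (k : seq nat) : nat :=
  (sumn k - (size k * (size k).+1) %/ 2)%N.

(* Main.v *)
Require Import Defs.
From HB Require Import structures.
From mathcomp Require Import all_boot all_order all_algebra.
From mathcomp Require Import polyXY.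
From mathcomp Require Import all_classical all_reals all_analysis.
From mathcomp Require Import complex ring.

Set Implicit Arguments.
Unset Strict Implicit.
Unset Printing Implicit Defensive.

Import Order.TTheory GRing.Theory Num.Theory.
Import numFieldNormedType.Exports.

Local Open Scope complex_scope.
Local Open Scope ring_scope.

(** Fix x and y, and let a_n and b_n be the coefficients of z^n in E(z, x, y)
and in E_k(z, x, y), with b_n = 0 for n in k.  Comparing coefficients in
E_k = E * sum_n z^n Q_n gives b_n = sum_(m <= n) a_m Q_(n-m) for n <= k_l + 1,
and a_0 = 1, so that
  Q_n = b_n - sum_(1 <= m <= n) a_m Q_(n-m).
This is (iii).  The rest is read off from this recursion.

(ii) Q_0 = b_0.  In the Wronskian of H_(k_1), ..., H_(k_l), H_0 the last column
is (1, 0, ..., 0), and H_k' = 2k H_(k-1), so that the cofactor left over is a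
multiple of the Wronskian of H_(k_1 - 1), ..., H_(k_l - 1)
([hermite_wr_rcons0]).

(i) The a_n and b_n are symmetric in x and y.  Since H_n has the parity of n
and derivation flips parity, a Wronskian of Hermite polynomials has a parity
too ([hermite_wr_parity]), hence a_n(-x, y) = (-1)^n a_n(x, y) and
b_n(-x, y) = (-1)^(kappa + n) b_n(x, y).  Both properties pass to Q_n by
induction along the recursion.

What needs analysis is the comparison of coefficients: the hypothesis is about
limits, and says something about the coefficients only once both series are
known to converge near z = 0.  The recurrence H_(n+1) = 2x H_n - 2n H_(n-1)
gives |H_n(x)| <= C^(n+1) sqrt(n!), and this kind of bound is stable under
derivation in x and under fixed linear combinations, hence holds for
H_(k,n)(x) as well, by expansion of the Wronskian along its last column
([hermite_wr_growth]).  In a_n and b_n the two square roots cancel the n! of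
the denominator, and |a_n|, |b_n| <= C^(n+1).  The remainders of order N are then
O(t^N) for small real t > 0 ([pseries_tail]), and a polynomial that is O(t^N)
near 0 has no coefficient below N ([coef_eq0_of_small]); applied to the
truncations of the two sides, this identifies the coefficients
([pseries_mul_coef]). *)

(** * Polynomials small near 0, and the Hermite recurrences *)

Lemma horner_bound (K : numFieldType) (p : {poly K}) (r : K) :
  0 <= r ->
  exists2 B : K, 0 <= B & forall t, 0 <= t <= r -> `|p.[t]| <= B.
Proof.
move=> r0; elim/poly_ind: p => [|p c [B B0 pB]].
  by exists 0 => // t _; rewrite horner0 normr0.
exists (B * r + `|c|) => [|t /andP[t0 tr]].
  by rewrite addr_ge0 ?mulr_ge0.
rewrite hornerMXaddC (le_trans (ler_normD _ _)) // lerD2r normrM.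
by rewrite ler_pM ?pB ?t0 // ger0_norm.
Qed.

(** Dividing by t: if p = p_1 X + c then |c| <= t S for all small t > 0, which
forces c = 0, and p_1 satisfies the same hypothesis with N - 1.  Only positive
t are used, so that in the application real values of z suffice. *)
Lemma coef_eq0_of_small (K : numFieldType) (p : {poly K}) (N : nat) (r M : K) :
  0 < r -> (forall t, 0 < t <= r -> `|p.[t]| <= M * t ^+ N) ->
  forall i, (i < N)%N -> p`_i = 0.
Proof.
move=> r0; elim: N p => [//|N IHN] p pM.
have [[p1 c] pE] : exists pc : {poly K} * K, p = pc.1 * 'X + pc.2%:P.
  elim/poly_ind: p pM => [|q c _ _]; last by exists (q, c).
  by exists (0, 0); rewrite mul0r add0r.
rewrite {}pE /= in pM *.
have [B B0 p1B] := horner_bound p1 (ltW r0).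
have M0 : 0 <= M.
  have := pM r; rewrite r0 lexx => /(_ isT) /(le_trans (normr_ge0 _)).
  by rewrite pmulr_lge0 // exprn_gt0.
pose S := B + M * r ^+ N + 1.
have S0 : 0 < S.
  by rewrite ltr_wpDl // addr_ge0 // mulr_ge0 // exprn_ge0 // ltW.
have cS t : 0 < t <= r -> `|c| <= t * S.
  move=> /andP[t0 tr]; have t0' := ltW t0.
  have -> : c = (p1 * 'X + c%:P).[t] - p1.[t] * t by rewrite hornerMXaddC addrC addKr.
  apply: le_trans (ler_normB _ _) _.
  have := pM t; rewrite t0 tr => /(_ isT) pMt.
  apply: le_trans (lerD pMt _) (_ : M * t ^+ N.+1 + B * t <= _).
    by rewrite normrM (ger0_norm t0') ler_wpM2r // p1B // t0' tr.
  have -> : M * t ^+ N.+1 + B * t = t * (B + M * t ^+ N) by rewrite exprS; ring.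
  rewrite ler_wpM2l // /S ler_wpDr // lerD2l ler_wpM2l //.
  by rewrite lerXn2r // ?nnegrE ?(ltW r0).
have c0 : c = 0.
  apply/eqP; apply: contraT => cn0.
  have c0 : 0 < `|c| by rewrite normr_gt0.
  have [t /andP[t0 tr] tS] : exists2 t, 0 < t <= r & t * S < `|c|.
    have rS0 : 0 < r * S by rewrite mulr_gt0.
    have d0 : 0 < 2%:R * (r * S + `|c|) by rewrite mulr_gt0 ?ltr0n // addr_gt0.
    have rc0 : 0 < r * `|c| by rewrite mulr_gt0.
    (* The denominator exceeds both r S and |c|: the first makes t S < |c|,
       the second makes t <= r. *)
    exists (r * `|c| / (2%:R * (r * S + `|c|))).
      apply/andP; split; first by rewrite divr_gt0.
      rewrite ler_pdivrMr // ler_wpM2l ?(ltW r0) //.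
      rewrite (mulrDr 2%:R (r * S)) ler_wpDl // ?ler_peMl ?ler1n ?(ltW c0) //.
      by rewrite mulr_ge0 ?ler0n ?(ltW rS0).
    rewrite mulrAC ltr_pdivrMr // mulrAC mulrC ltr_pM2l // (mulrDr 2%:R (r * S)).
    rewrite ltr_wpDr ?mulr_ge0 ?ler0n ?(ltW c0) // ltr_pMl ?ltr1n //.
  by have := le_lt_trans (cS t _) tS; rewrite t0 tr ltxx => /(_ isT).
case=> [|i] iN; rewrite coefD coefMX coefC /= ?c0 ?add0r ?addr0 //.
apply: IHN => // t tr; have /andP[t0 _] := tr.
have := pM t tr; rewrite hornerMXaddC c0 addr0 normrM (gtr0_norm t0).
by rewrite exprSr mulrA ler_pM2r.
Qed.

(** The vanishing difference satisfies the smallness bound of every order,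
with M = 0. *)
Lemma eq_poly_horner (K : numFieldType) (p q : {poly K}) :
  (forall x, p.[x] = q.[x]) -> p = q.
Proof.
move=> pq; apply/polyP => i; apply/eqP; rewrite -subr_eq0 -coefB; apply/eqP.
apply: (@coef_eq0_of_small K (p - q) i.+1 1 0) => // t _.
by rewrite hornerD hornerN pq subrr normr0 mul0r.
Qed.

Lemma rodrigues_uniq (R : realType) (n : nat) (p q : {poly R}) :
  rodrigues n p -> rodrigues n q -> p = q.
Proof. by move=> pP qP; apply: eq_poly_horner => x; rewrite pP qP. Qed.

Lemma rodrigues0 (R : realType) : rodrigues 0 (1 : {poly R}).
Proof. by move=> x; rewrite hornerC expr0 mul1r /= -expRD addrN expR0. Qed.

(** One derivation of g = exp(-t^2) turns (-1)^n g p, which is the n-th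
derivative of g, into (-1)^n g (p' - 2 t p). *)
Lemma rodriguesS (R : realType) (n : nat) (p : {poly R}) :
  rodrigues n p -> rodrigues n.+1 (2%:R *: ('X * p) - p^`()).
Proof.
move=> pP x.
pose g t : R := expR (- (t ^+ 2)).
have gV t : expR (t ^+ 2) * g t = 1 by rewrite -expRD addrN expR0.
have dnE : derive1n n g = (-1) ^+ n *: (g * horner p).
  apply/funext => t; rewrite !fctE /GRing.scale /= pP -/g.
  transitivity ((-1) ^+ n * (-1) ^+ n * (expR (t ^+ 2) * g t) * derive1n n g t).
    by rewrite gV -exprMn mulrNN !mulr1 expr1n !mul1r.
  by ring.
have dp : is_derive x 1 (horner p) p^`().[x].
  by rewrite derivE derive1E; apply: DeriveDef => //; exact: derivable_horner.
have dg : is_derive x 1 g (g x * - (2%:R * x)).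
  apply: (@is_derive1_comp _ (@expR R) (fun t => - (t ^+ 2))).
  by apply: is_derive_eq; rewrite /GRing.scale /= mulr1; ring.
rewrite derive1nS -/g dnE derive1E derive_val /GRing.scale /= exprS.
transitivity ((-1) ^+ n * (-1) ^+ n * (expR (x ^+ 2) * g x) * (2%:R * x * p.[x] - p^`().[x])).
  rewrite gV -exprMn mulrNN !mulr1 expr1n !mul1r.
  by rewrite hornerD hornerN hornerZ hornerM hornerX mulrA.
by rewrite mulN1r; ring.
Qed.

Lemma hermite0 (R : realType) : hermite R 0 = 1.
Proof. exact: rodrigues_uniq (@hermiteP R 0) (@rodrigues0 R). Qed.

Lemma hermiteS (R : realType) (n : nat) :
  hermite R n.+1 = 2%:R *: ('X * hermite R n) - (hermite R n)^`().
Proof. exact: rodrigues_uniq (@hermiteP R n.+1) (rodriguesS (@hermiteP R n)). Qed.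

Lemma hermiteC0 (R : realType) : hermiteC R 0 = 1.
Proof. by rewrite /hermiteC hermite0 rmorph1. Qed.

Lemma hermiteCS (R : realType) (n : nat) :
  hermiteC R n.+1 = 2%:R *: ('X * hermiteC R n) - (hermiteC R n)^`().
Proof.
by rewrite /hermiteC hermiteS rmorphB /= map_polyZ rmorphM /= map_polyX deriv_map rmorph_nat.
Qed.

(** By induction, differentiating H_(n+1) = 2X H_n - H_n' and recognising
2X H_(n-1) - H_(n-1)' = H_n in the result. *)
Lemma deriv_hermiteC (R : realType) (n : nat) :
  (hermiteC R n)^`() = (2 * n)%:R *: hermiteC R n.-1.
Proof.
elim: n => [|n IHn]; first by rewrite hermiteC0 -polyC1 derivC muln0 scale0r.
rewrite hermiteCS derivB derivZ derivM derivX mul1r IHn derivZ /=.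
case: n IHn => [|n] IHn.
  by rewrite !muln0 !scale0r mulr0 addr0 subr0 muln1.
rewrite -!scalerAr /= hermiteCS; move: (hermiteC R n) => h.
rewrite -!mul_polyC !rmorph_nat !natrM -[n.+2%:R]natr1.
by ring.
Qed.

(** * Growth of the Hermite polynomials at a point *)

(** The square root of n! is the true order of magnitude: since the Mehler
coefficient is a product of two Hermite values over n!, a bound such as C^n n!
would not give a positive radius of convergence.  The exponent n.+1 in
place of n lets C absorb constant factors. *)
Definition sqrt_fact_growth (K : numClosedFieldType) (u : nat -> K) : Prop :=
  exists2 C : K, 0 <= C & forall n, `|u n| <= C ^+ n.+1 * sqrtC n`!%:R.

Lemma sqrt_fact_ge0 (K : numClosedFieldType) (n : nat) : 0 <= sqrtC n`!%:R :> K.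
Proof. by rewrite sqrtC_ge0 ler0n. Qed.

Lemma sqrt_fact_growthD (K : numClosedFieldType) (u v : nat -> K) :
  sqrt_fact_growth u -> sqrt_fact_growth v ->
  sqrt_fact_growth (fun n => u n + v n).
Proof.
move=> [C C0 uC] [D D0 vD]; exists (C + D) => [|n]; first exact: addr_ge0.
apply: le_trans (ler_normD _ _) _; apply: le_trans (lerD (uC n) (vD n)) _.
rewrite -mulrDl ler_wpM2r ?sqrt_fact_ge0 //.
elim: n => [|n IHn]; first by rewrite !expr1.
rewrite [leRHS]exprS; apply: le_trans (ler_wpM2l (addr_ge0 C0 D0) IHn).
rewrite mulrDl !mulrDr -!exprS lerD //.
  by rewrite lerDl mulr_ge0 ?exprn_ge0.
by rewrite lerDr mulr_ge0 ?exprn_ge0.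
Qed.

Lemma sqrt_fact_growthM (K : numClosedFieldType) (c : nat -> K) (u : nat -> K) (D : K) :
  0 <= D -> (forall n, `|c n| <= D ^+ n.+1) -> sqrt_fact_growth u ->
  sqrt_fact_growth (fun n => c n * u n).
Proof.
move=> D0 cD [C C0 uC]; exists (D * C) => [|n]; first exact: mulr_ge0.
by rewrite normrM exprMn -mulrA ler_pM.
Qed.

Lemma le_Xn1 (K : numDomainType) (c : K) (n : nat) : 0 <= c -> c <= (c + 1) ^+ n.+1.
Proof.
move=> c0; apply: le_trans (_ : c + 1 <= _); first by rewrite lerDl.
by rewrite ler_eXnr // lerDr.
Qed.

Lemma sqrt_fact_growth_sum (K : numClosedFieldType) (m : nat) (c : 'I_m -> K)
    (u : 'I_m -> nat -> K) :
  (forall i, sqrt_fact_growth (u i)) ->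
  sqrt_fact_growth (fun n => \sum_(i < m) c i * u i n).
Proof.
elim: m c u => [|m IHm] c u uG.
  by exists 0 => // n; rewrite big_ord0 normr0 mulr_ge0 ?exprn_ge0 ?sqrt_fact_ge0.
under [X in sqrt_fact_growth X]funext do rewrite big_ord_recr /=.
apply: sqrt_fact_growthD; first by apply: IHm => i; exact: uG.
apply: (@sqrt_fact_growthM _ (fun=> c ord_max) _ (`|c ord_max| + 1)) (uG _) => [|n].
  by rewrite addr_ge0.
exact: le_Xn1.
Qed.

Lemma sqrt_factS (K : numClosedFieldType) (n : nat) :
  sqrtC n.+1`!%:R = sqrtC n.+1%:R * sqrtC n`!%:R :> K.
Proof. by rewrite factS natrM sqrtCM ?nnegrE ?ler0n. Qed.

Lemma sqrtC_nat_mono (K : numClosedFieldType) (m n : nat) : (m <= n)%N ->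
  sqrtC m%:R <= sqrtC n%:R :> K.
Proof. by move=> mn; rewrite ler_sqrtC ?nnegrE ?ler0n // ler_nat. Qed.

Lemma sqrtC_natS_ge1 (K : numClosedFieldType) (n : nat) : 1 <= sqrtC n.+1%:R :> K.
Proof. by have := sqrtC_nat_mono K (ltn0Sn n); rewrite sqrtC1. Qed.

(** In H_(n+1) = 2x H_n - 2n H_(n-1) the factor n splits as sqrt(n) sqrt(n):
one root completes sqrt((n-1)!) to sqrt(n!), the other is at most the sqrt(n+1)
gained on the right.  What remains is 2|x| C + 2 C <= C^2, an equality for
C = 2|x| + 2. *)
Lemma hermiteC_growth (R : realType) (x : R[i]) :
  sqrt_fact_growth (fun n => (hermiteC R n).[x]).
Proof.
pose C : R[i] := 2%:R * `|x| + 2%:R.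
have C1 : 1 <= C by rewrite (@le_trans _ _ 2%:R) ?ler1n // lerDr mulr_ge0 ?ler0n.
have C0 : 0 <= C := le_trans ler01 C1.
exists C => // n.
suff: `|(hermiteC R n).[x]| <= C ^+ n.+1 * sqrtC n`!%:R /\
      `|(hermiteC R n.+1).[x]| <= C ^+ n.+2 * sqrtC n.+1`!%:R by case.
elim: n => [|n [IH0 IH1]].
  rewrite hermiteCS hermiteC0 -polyC1 derivC subr0 mulr1 hornerZ hornerX hornerC.
  rewrite normr1 fact0 sqrtC1 !mulr1; split => //.
  rewrite normrM ger0_norm ?ler0n // (@le_trans _ _ C) //.
    by rewrite lerDl ler0n.
  by rewrite ler_eXnr.
split=> //; rewrite hermiteCS deriv_hermiteC hornerD hornerN !hornerZ hornerM hornerX.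
apply: le_trans (ler_normB _ _) _; rewrite !normrM /=.
apply: (@le_trans _ _ (2%:R * `|x| * (C ^+ n.+2 * sqrtC n.+1`!%:R)
                       + (2 * n.+1)%:R * (C ^+ n.+1 * sqrtC n`!%:R))).
  by rewrite !normr_nat -mulrA lerD // !ler_wpM2l ?ler0n.
have nE : n.+1%:R = sqrtC n.+1%:R * sqrtC n.+1%:R :> R[i] by rewrite -expr2 sqrtCK.
rewrite natrM nE.
have -> : 2 * (sqrtC n.+1%:R * sqrtC n.+1%:R) * (C ^+ n.+1 * sqrtC n`!%:R) =
   2 * sqrtC n.+1%:R * C ^+ n.+1 * sqrtC n.+1`!%:R :> R[i] by rewrite sqrt_factS; ring.
apply: (@le_trans _ _ (C ^+ n.+3 * sqrtC n.+2%:R * sqrtC n.+1`!%:R)); last first.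
  by rewrite [in X in _ <= X]sqrt_factS mulrA.
rewrite mulrA -mulrDl ler_wpM2r ?sqrt_fact_ge0 //.
have s1 : 1 <= sqrtC n.+2%:R :> R[i] by exact: sqrtC_natS_ge1.
have s0 := le_trans ler01 s1.
apply: (@le_trans _ _ (2%:R * `|x| * C ^+ n.+2 * sqrtC n.+2%:R + 2 * C ^+ n.+2 * sqrtC n.+2%:R)).
  apply: lerD.
    by apply: ler_peMr => //; apply: mulr_ge0; [exact: mulr_ge0 | exact: exprn_ge0].
  rewrite mulrAC; apply: ler_pM; rewrite ?mulr_ge0 ?exprn_ge0 ?sqrtC_ge0 ?ler0n //.
    by rewrite ler_wpM2l ?ler0n // [leRHS]exprS ler_peMl ?exprn_ge0.
  exact: sqrtC_nat_mono.
by rewrite -mulrDl -mulrDl ler_wpM2r // -/C -exprS.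
Qed.

(** Each derivation brings a factor 2n = 2 sqrt(n) sqrt(n) and lowers the
index: one root is absorbed by the factorial, the other by 2^n. *)
Lemma derivn_hermiteC_growth (R : realType) (x : R[i]) (i : nat) :
  sqrt_fact_growth (fun n => (derivn i (hermiteC R n)).[x]).
Proof.
elim: i => [|i [C C0 IHi]]; first exact: hermiteC_growth.
have C1 : C <= C + 1 by rewrite lerDl.
have C1_0 : 0 <= C + 1 by rewrite addr_ge0.
exists (2%:R * 2%:R * (C + 1)) => [|n]; first by rewrite !mulr_ge0 ?ler0n.
rewrite derivSn deriv_hermiteC derivnZ hornerZ normrM normr_nat.
case: n => [|n].
  by rewrite muln0 mul0r mulr_ge0 ?exprn_ge0 ?mulr_ge0 ?ler0n ?sqrt_fact_ge0.
apply: (@le_trans _ _ ((2 * n.+1)%:R * (C ^+ n.+1 * sqrtC n`!%:R))).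
  by rewrite ler_wpM2l ?ler0n.
have nE : n.+1%:R = sqrtC n.+1%:R * sqrtC n.+1%:R :> R[i] by rewrite -expr2 sqrtCK.
have -> : (2 * n.+1)%:R * (C ^+ n.+1 * sqrtC n`!%:R) =
   2 * sqrtC n.+1%:R * C ^+ n.+1 * sqrtC n.+1`!%:R :> R[i].
  by rewrite sqrt_factS natrM; set s := sqrtC n.+1%:R in nE *; rewrite nE; ring.
rewrite ler_wpM2r ?sqrt_fact_ge0 // !exprMn.
apply: ler_pM; rewrite ?mulr_ge0 ?exprn_ge0 ?sqrtC_ge0 ?ler0n //.
  apply: ler_pM; rewrite ?ler0n ?sqrtC_ge0 ?ler_eXnr ?ler1n //.
  apply: (@le_trans _ _ n.+1%:R).
    by rewrite [leRHS]nE ler_peMl ?sqrtC_ge0 ?ler0n // sqrtC_natS_ge1.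
  by rewrite -natrX ler_nat ltnW // ltnW // ltn_expl.
apply: (@le_trans _ _ ((C + 1) ^+ n.+1)); first by rewrite lerXn2r ?nnegrE.
by rewrite [leRHS]exprS ler_peMl ?exprn_ge0 // lerDr.
Qed.

(** * Wronskians *)

Lemma wronskianE (F : comNzRingType) (m : nat) (fs : seq {poly F}) : size fs = m ->
  wronskian fs = \det (\matrix_(i < m, j < m) derivn i fs`_j).
Proof. by move=> <-. Qed.

(** Only the last column involves f: the cofactors along it can be computed
with 0 in place of f. *)
Lemma wronskian_rcons (F : comNzRingType) (fs : seq {poly F}) :
  exists W : 'I_(size fs).+1 -> {poly F}, forall f,
    wronskian (rcons fs f) = \sum_i W i * derivn i f.
Proof.
pose A f := \matrix_(i < (size fs).+1, j < (size fs).+1) derivn i (rcons fs f)`_j.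
exists (fun i => cofactor (A 0) i ord_max) => f.
rewrite (@wronskianE _ (size fs).+1) ?size_rcons // -/(A f).
rewrite (expand_det_col _ ord_max); apply: eq_bigr => i _.
rewrite mulrC mxE nth_rcons ltnn eqxx; congr (_ * _).
rewrite /cofactor; congr (_ * \det _); apply/matrixP => i' j'.
by rewrite !mxE !nth_rcons lift_max ltn_ord.
Qed.

Lemma det_scale (F : comNzRingType) (m : nat) (r c : nat -> F) (A : 'M[F]_m) :
  \det (\matrix_(i < m, j < m) (r i * c j * A i j)) =
  (\prod_(i < m) r i) * (\prod_(j < m) c j) * \det A.
Proof.
rewrite (_ : \matrix_(_, _) _ =
  diag_mx (\row_i r i) *m A *m diag_mx (\row_j c j)); last first.
  by apply/matrixP => i j; rewrite mul_mx_diag mul_diag_mx !mxE mulrAC.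
rewrite !det_mulmx !det_diag mulrAC; congr (_ * _ * _); apply: eq_bigr => i _;
by rewrite mxE.
Qed.

Definition has_parity (F : comNzRingType) (d : nat) (p : {poly F}) : Prop :=
  p \Po (- 'X) = (-1) ^+ d * p.

Lemma has_parity_horner (F : comNzRingType) (d : nat) (p : {poly F}) (x : F) :
  has_parity d p -> p.[- x] = (-1) ^+ d * p.[x].
Proof.
move=> /(congr1 (horner^~ x)); rewrite horner_comp hornerN hornerX => ->.
by rewrite hornerM -polyCN -polyC_exp hornerC.
Qed.

(** The chain rule for p(-X) contributes one sign per derivation. *)
Lemma has_parity_derivn (F : comNzRingType) (d : nat) (p : {poly F}) (i : nat) :
  has_parity d p -> has_parity (d + i) (derivn i p).
Proof.
rewrite /has_parity; elim: i => [|i IHi] pP; first by rewrite addn0.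
rewrite addnS derivnS exprS -mulrA mulN1r.
move/(congr1 (@deriv F)): (IHi pP); rewrite deriv_comp derivN derivX mulrN1.
rewrite -polyCN -polyC_exp mul_polyC derivZ -mul_polyC => <-.
by rewrite opprK.
Qed.

Lemma hermiteC_parity (R : realType) (n : nat) : has_parity n (hermiteC R n).
Proof.
elim: n => [|n IHn]; first by rewrite hermiteC0 /has_parity rmorph1 expr0 mul1r.
have := has_parity_derivn 1 IHn.
rewrite /has_parity derivn1 hermiteCS addn1 => dP.
rewrite rmorphB /= comp_polyZ rmorphM /= comp_polyX IHn dP !exprS.
by rewrite -!mul_polyC; ring.
Qed.

(** The (i, j) entry of the Wronskian matrix has parity j-th index + i; the
signs of the rows and of the columns factor out of the determinant, and
0 + 1 + ... + (m - 1) = 'C(m, 2). *)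
Lemma hermite_wr_parity (R : realType) (js : seq nat) :
  has_parity (sumn js + 'C(size js, 2)) (hermite_wr R js).
Proof.
rewrite /has_parity /hermite_wr (@wronskianE _ (size js)) ?size_map //.
rewrite -det_map_mx.
set A := \matrix_(_, _) _.
rewrite (_ : map_mx _ A = \matrix_(i < size js, j < size js)
   ((-1) ^+ i * (-1) ^+ nth 0%N js j * A i j)); last first.
  apply/matrixP => i j; rewrite !mxE (nth_map 0%N) // -exprD addnC.
  exact: (has_parity_derivn i (hermiteC_parity R _)).
rewrite (det_scale (fun i => (-1) ^+ i) (fun j => (-1) ^+ nth 0%N js j)).
congr (_ * _); rewrite !prodrXr -exprD addnC; congr (_ ^+ (_ + _)).
  by rewrite sumnE (big_nth 0%N) big_mkord.
by rewrite -bin2_sum big_mkord.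
Qed.

(** Expand along the last column (1, 0, ..., 0): the remaining minor consists
of the derivatives of the H_(k_j)' = 2 k_j H_(k_j - 1). *)
Lemma hermite_wr_rcons0 (R : realType) (k : seq nat) :
  hermite_wr R (rcons k 0%N) =
  (-1) ^+ size k * (\prod_(j <- k) (2 * j)%:R) *
    hermite_wr R [seq j.-1 | j <- k].
Proof.
rewrite /hermite_wr (@wronskianE _ (size k).+1) ?size_map ?size_rcons //.
rewrite (@wronskianE _ (size k)) ?size_map //.
rewrite (expand_det_col _ ord_max) big_ord_recl big1 => [|i _]; last first.
  by rewrite mxE map_rcons nth_rcons size_map ltnn eqxx hermiteC0
    lift0 -polyC1 derivnC mul0r.
rewrite addr0 mxE map_rcons nth_rcons size_map ltnn eqxx hermiteC0 mul1r.
rewrite /cofactor add0n /= -mulrA; congr (_ * _).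
pose A : 'M[{poly R[i]}]_(size k) :=
  \matrix_(i, j) derivn i [seq hermiteC R n | n <- [seq j.-1 | j <- k]]`_j.
transitivity (\det (\matrix_(i < size k, j < size k)
    (1 * (2 * nth 0%N k j)%:R * A i j))).
  congr (\det _); apply/matrixP => i j.
  rewrite !mxE nth_rcons size_map lift_max ltn_ord lift0 -map_comp !(nth_map 0%N) //.
  by rewrite mul1r derivSn deriv_hermiteC derivnZ -mul_polyC rmorph_nat.
rewrite (det_scale (fun=> 1) (fun j => (2 * nth 0%N k j)%:R)) big1 // mul1r.
by rewrite (big_nth 0%N) big_mkord.
Qed.

Lemma hermite_wr_growth (R : realType) (k : seq nat) (x : R[i]) :
  sqrt_fact_growth (fun n => (hermite_wr R (rcons k n)).[x]).
Proof.
rewrite /hermite_wr.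
have [W WE] := wronskian_rcons [seq hermiteC R n | n <- k].
under [X in sqrt_fact_growth X]funext => n.
  rewrite map_rcons WE horner_sum.
  under eq_bigr do rewrite hornerM.
  over.
apply: sqrt_fact_growth_sum => i; exact: derivn_hermiteC_growth.
Qed.

(** * Geometrically dominated complex series *)

Lemma normc_real (R : rcfType) (x : R) : `|x%:C| = `|x|%:C.
Proof. by rewrite normc_def /= expr0n addr0 sqrtr_sqr. Qed.

(** Convergence in the plane is obtained from its two coordinates, so that the
completeness of the real line is all that is needed below. *)
Lemma cvg_complex (R : realType) (u : nat -> R[i]) (a b : R) :
  (complex.Re (u n) @[n --> \oo] --> a)%classic ->
  (complex.Im (u n) @[n --> \oo] --> b)%classic ->
  ((u n : R[i]^o) @[n --> \oo] --> (a +i* b : R[i]^o))%classic.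
Proof.
move=> /cvgrPdist_le ua /cvgrPdist_le ub; apply/cvgrPdist_le => e e0.
have eE : e = (complex.Re e)%:C by rewrite RRe_real // gtr0_real.
have e20 : 0 < complex.Re e / 2%:R.
  by rewrite divr_gt0 // -ltcR -eE.
near=> n.
rewrite [_ - _]complexE; apply: le_trans (ler_normD _ _) _.
have -> : `|'i%C * (complex.Im (a +i* b - u n))%:C| = `|complex.Im (a +i* b - u n)|%:C.
  by rewrite normrM normc_def /= expr0n expr1n add0r sqrtr1 mul1r normc_real.
rewrite normc_real -rmorphD eE lecR [leRHS]splitr.
rewrite lerD //; [near: n; move: (ua _ e20) | near: n; move: (ub _ e20)].
  by apply: filterS => n; case: (u n).
by apply: filterS => n; case: (u n).
Unshelve. all: by end_near. Qed.

Lemma is_cvg_series_geo (R : realType) (v : nat -> R) (M q : R) :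
  0 <= q < 1 -> (forall n, `|v n| <= M * q ^+ n) -> cvgn (series v).
Proof.
move=> /andP[q0 q1] vM; apply: normed_cvg.
apply: (@series_le_cvg _ _ (geometric M q)).
- by move=> n; exact: normr_ge0.
- by move=> n; apply: le_trans (normr_ge0 _) (vM n).
- exact: vM.
- by apply: is_cvg_geometric_series; rewrite ger0_norm.
Qed.

Lemma is_cvg_seriesC_geo (R : realType) (u : nat -> R[i]^o) (M q : R) :
  0 <= q < 1 -> (forall n, `|u n| <= (M * q ^+ n)%:C) -> cvgn (series u).
Proof.
move=> q01 uM.
have ReM n : `|complex.Re (u n)| <= M * q ^+ n.
  by rewrite -lecR; apply: le_trans (normc_ge_Re _) (uM n).
have ImM n : `|complex.Im (u n)| <= M * q ^+ n.
  rewrite -lecR -normrN -complex.ReiNIm; apply: le_trans (normc_ge_Re _) _.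
  by rewrite normrM [`|'i%C|]normc_def /= expr0n expr1n add0r sqrtr1 mulr1.
have /cvg_ex[a ua] := is_cvg_series_geo q01 ReM.
have /cvg_ex[b ub] := is_cvg_series_geo q01 ImM.
apply/cvg_ex; exists (a +i* b).
apply: cvg_complex.
  by have := ua; rewrite /series /=; under [in X in _ -> X]eq_fun do rewrite raddf_sum.
by have := ub; rewrite /series /=; under [in X in _ -> X]eq_fun do rewrite raddf_sum.
Qed.

(** The blocks of terms from N to N + n are dominated by a telescoping
difference, hence by the full geometric tail, uniformly in n; then let n go to
infinity. *)
Lemma seriesC_geo_tail (R : realType) (u : nat -> R[i]^o) (M q : R) (N : nat) :
  0 <= q < 1 -> (forall n, `|u n| <= (M * q ^+ n)%:C) ->
  `|limn (series u) - \sum_(0 <= n < N) u n| <= (M * q ^+ N / (1 - q))%:C.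
Proof.
move=> q01 uM; have /andP[q0 q1] := q01.
have qn1 : 0 < 1 - q by rewrite subr_gt0.
have block n : `|\sum_(N <= i < N + n) u i| <= (M * q ^+ N / (1 - q))%:C.
  apply: le_trans (ler_norm_sum _ _ _) _.
  apply: (@le_trans _ _ (M * q ^+ N / (1 - q) - M * q ^+ (N + n) / (1 - q))%:C).
    elim: n => [|n IHn]; first by rewrite big_geq ?addn0 // subrr.
    rewrite addnS big_nat_recr ?leq_addr //=.
    apply: le_trans (lerD IHn (uM _)) _.
    rewrite -rmorphD lecR exprS le_eqVlt; apply/orP; left; apply/eqP.
    by field; rewrite gt_eqF.
  rewrite lecR gerBl.
  have := le_trans (normr_ge0 _) (uM 0%N); rewrite expr0 mulr1 lecR => M0.
  by rewrite !mulr_ge0 ?exprn_ge0 ?invr_ge0 ?(ltW qn1).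
have /cvgrPdist_le ul := is_cvg_seriesC_geo q01 uM.
apply/ler_addgt0Pl => e /ul [m _ um].
have {um} := um (N + m)%N (leq_addl _ _).
rewrite /series /= (@big_cat_nat _ _ _ N) ?leq_addr //= => um.
set l := limn _ in um *; set S := \sum_(0 <= _ < N) _ in um *.
rewrite (_ : l - S = l - (S + \sum_(N <= i < N + m) u i) + \sum_(N <= i < N + m) u i).
  by apply: le_trans (ler_normD _ _) _; exact: lerD.
by rewrite opprD addrA subrK.
Qed.

(** * Comparison of coefficients *)

Definition geometric_growth (K : numDomainType) (c : nat -> K) : Prop :=
  exists2 C : K, 0 <= C & forall n, `|c n| <= C ^+ n.+1.

(** The hypothesis is free of quotients, so that the same lemma serves for
the Mehler coefficients and for the coefficients of E_k, which are set to 0 on k. *)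
Lemma geometric_growth_prod (K : numClosedFieldType) (u v c : nat -> K) :
  sqrt_fact_growth u -> sqrt_fact_growth v ->
  (forall n, `|c n| * n`!%:R <= `|u n| * `|v n|) -> geometric_growth c.
Proof.
move=> [C C0 uC] [D D0 vD] cuv; exists (C * D) => [|n]; first exact: mulr_ge0.
have f0 : 0 < n`!%:R :> K by rewrite ltr0n fact_gt0.
rewrite -(ler_pM2r f0); apply: le_trans (cuv n) _.
apply: le_trans (ler_pM _ _ (uC n) (vD n)) _ => //.
rewrite exprMn -{3}[n`!%:R]sqrtCK expr2 le_eqVlt; apply/orP; left; apply/eqP.
by ring.
Qed.

Lemma mehler_coef_growth (R : realType) (x y : R[i]) :
  geometric_growth (fun n => mehler_coef n x y).
Proof.
apply: (geometric_growth_prod (hermiteC_growth x) (hermiteC_growth y)) => n /=.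
rewrite /mehler_coef normrM normfV !normrM normrX !normr_nat.
rewrite -[leLHS]mulrA; apply: ler_piMr; rewrite ?mulr_ge0 //.
rewrite invfM -mulrA mulVf ?mulr1; last first.
  by rewrite pnatr_eq0 -lt0n fact_gt0.
by rewrite invf_le1 ?exprn_gt0 ?ltr0n // -natrX ler1n expn_gt0.
Qed.

(** For n outside k each factor n - k_j is a nonzero integer, so the
denominator is at least n! in modulus. *)
Lemma exc_coef_growth (R : realType) (k : seq nat) (x y : R[i]) :
  geometric_growth (fun n => if n \in k then 0 else exc_coef k n x y).
Proof.
apply: (geometric_growth_prod (hermite_wr_growth k x) (hermite_wr_growth k y)) => n /=.
case: ifPn => [_|nk]; first by rewrite normr0 mul0r mulr_ge0.
rewrite /exc_coef normrM normfV !normrM normrX !normr_nat normr_prod.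
set P := \prod_(j <- k) _.
have P1 : 1 <= P.
  rewrite /P big_seq; elim/big_ind: _ => [//|a b a1 b1|j jk].
    by rewrite mulr_ege1.
  have -> : n%:R - j%:R = (n%:Z - j%:Z)%:~R :> R[i] by rewrite rmorphB.
  rewrite -intr_norm -[1]/(1%:~R) ler_int.
  have : n%:Z - j%:Z != 0.
    by rewrite subr_eq0 eqz_nat; apply: contra nk => /eqP ->.
  by rewrite -normr_gt0.
rewrite -[leLHS]mulrA; apply: ler_piMr; rewrite ?mulr_ge0 //.
rewrite mulrAC invfM -mulrA mulVf ?mulr1; last first.
  by rewrite pnatr_eq0 -lt0n fact_gt0.
rewrite invf_le1 ?mulr_gt0 ?exprn_gt0 ?ltr0n ?(lt_le_trans ltr01 P1) //.
by rewrite mulr_ege1 // -natrX ler1n expn_gt0.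
Qed.

(** Here 1/2 only bounds the factor 1 / (1 - t d) by 2; what matters is that the
remainder is O(t^N) with a constant independent of t. *)
Lemma pseries_tail (R : realType) (c : nat -> R[i]) (d t : R) (N : nat) :
  0 <= d -> (forall n, `|c n| <= (d ^+ n.+1)%:C) -> 0 <= t -> t * d <= 2^-1 ->
  `|limn (series (fun n => t%:C ^+ n * c n : R[i]^o))
    - \sum_(0 <= n < N) t%:C ^+ n * c n| <= (2%:R * d ^+ N.+1)%:C * t%:C ^+ N.
Proof.
move=> d0 cd t0 td.
have h1 : 2^-1 < 1 :> R by rewrite invf_lt1 ?ltr1n.
have q01 : 0 <= t * d < 1 by rewrite mulr_ge0 //= (le_lt_trans td).
have q1 : 0 < 1 - t * d by rewrite subr_gt0; case/andP: q01.
apply: le_trans (@seriesC_geo_tail _ _ d (t * d) N q01 _) _ => [n|].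
  rewrite normrM normrX normc_real (ger0_norm t0) exprMn mulrCA -exprS rmorphM rmorphXn.
  by rewrite ler_wpM2l // exprn_ge0 // lecR.
rewrite -rmorphXn -rmorphM lecR exprMn ler_pdivrMr //.
rewrite (_ : d * _ = d ^+ N.+1 * t ^+ N); last by rewrite exprS; ring.
rewrite [leRHS](_ : _ = (2%:R * (1 - t * d)) * (d ^+ N.+1 * t ^+ N)); last by ring.
rewrite ler_peMl ?mulr_ge0 ?exprn_ge0 //.
rewrite -ler_pdivrMl ?ltr0n // mulr1.
by rewrite lerBrDr -lerBrDl [1 - _](_ : _ = 2^-1) //; field.
Qed.

(** Let A, B be the two series truncated at order n + 1, q the polynomial
factor and la, lb the limits.  Since lb = la q(t),
B(t) - A(t) q(t) = (la - A(t)) q(t) - (lb - B(t)) = O(t^(n+1)),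
and the n-th coefficient of the polynomial B - A q must vanish. *)
Lemma pseries_mul_coef (R : realType) (a b q : nat -> R[i]) (L : nat) :
  geometric_growth a -> geometric_growth b ->
  (forall z : R[i], `|z| < 1 ->
    limn (series (fun n => z ^+ n * b n : R[i]^o)) =
    limn (series (fun n => z ^+ n * a n : R[i]^o)) *
      \sum_(0 <= n < L) z ^+ n * q n) ->
  forall n, (n < L)%N -> b n = \sum_(0 <= m < n.+1) a m * q (n - m)%N.
Proof.
move=> [A A0 aA] [B B0 bB] E n nL.
have reC z : 0 <= z -> {d : R | 0 <= d & z = d%:C}.
  move=> z0; have zE : z = (complex.Re z)%:C by rewrite RRe_real // ger0_real.
  by exists (complex.Re z) => //; rewrite -lecR -zE.
have [da da0 AE] := reC _ A0; have [db db0 BE] := reC _ B0.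
have a_da m : `|a m| <= (da ^+ m.+1)%:C by rewrite rmorphXn /= -AE.
have b_db m : `|b m| <= (db ^+ m.+1)%:C by rewrite rmorphXn /= -BE.
pose pa := \poly_(m < n.+1) a m; pose pb := \poly_(m < n.+1) b m.
pose pq := \poly_(m < L) q m.
(* The radius makes t * da and t * db at most 1/2, and t < 1. *)
pose r : R := (2%:R * (da + db + 1))^-1.
have s0 : 0 < da + db + 1 by rewrite ltr_wpDl // addr_ge0.
have r0 : 0 < r by rewrite invr_gt0 mulr_gt0 ?ltr0n.
have rle t d : 0 <= t -> t <= r -> d <= da + db + 1 -> t * d <= 2^-1.
  move=> t0 tr dle; apply: (@le_trans _ _ (t * (da + db + 1))).
    by rewrite ler_wpM2l.
  by rewrite -ler_pdivlMr // -invfM.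
have r0C : 0 < r%:C by rewrite ltcR.
have [Bq Bq0 pqB] := horner_bound pq (ltW r0C).
have poly_sumE (m : nat) (c : nat -> R[i]) z :
    (\poly_(i < m) c i).[z] = \sum_(0 <= i < m) z ^+ i * c i.
  by rewrite horner_poly big_mkord; apply: eq_bigr => i _; rewrite mulrC.
have small z : 0 < z <= r%:C ->
    `|(pb - pa * pq).[z]| <=
    ((2%:R * db ^+ n.+2)%:C + (2%:R * da ^+ n.+2)%:C * Bq) * z ^+ n.+1.
  move=> /andP[z0 zr]; have [t t0 zE] := reC _ (ltW z0).
  have tr : t <= r by rewrite -lecR -zE.
  have tda : t * da <= 2^-1 by apply: rle t0 tr _; rewrite -addrA lerDl addr_ge0.
  have tdb : t * db <= 2^-1 by apply: rle t0 tr _; rewrite -addrA addrCA lerDl addr_ge0.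
  have tb := pseries_tail n.+1 db0 b_db t0 tdb.
  have ta := pseries_tail n.+1 da0 a_da t0 tda.
  have z1 : `|z| < 1.
    rewrite gtr0_norm // (le_lt_trans zr) // -[1]/(1%:C) ltcR invf_lt1 ?mulr_gt0 ?ltr0n //.
    apply: (@lt_le_trans _ _ 2%:R); first by rewrite ltr1n.
    by rewrite ler_peMr ?ler0n // lerDr addr_ge0.
  have Ez := E z z1.
  rewrite hornerD hornerN hornerM !poly_sumE -zE in tb ta Ez *.
  have pqz : `|\sum_(0 <= i < L) z ^+ i * q i| <= Bq.
    by rewrite -poly_sumE pqB // (ltW z0).
  set lb := limn _ in tb Ez; set la := limn _ in ta Ez.
  move: pqz Ez tb ta; set Sq := \sum_(_ <= _ < L) _.
  set Sb := \sum_(_ <= _ < n.+1) (_ * b _); set Sa := \sum_(_ <= _ < n.+1) _.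
  move=> pqz Ez tb ta.
  rewrite (_ : Sb - Sa * Sq = (la - Sa) * Sq - (lb - Sb)); last by rewrite Ez; ring.
  apply: le_trans (ler_normB _ _) _; rewrite [leLHS]addrC [leRHS]mulrDl lerD // normrM mulrAC.
  by rewrite ler_pM.
have := coef_eq0_of_small r0C small (ltnSn n).
rewrite coefB coef_poly ltnSn => /eqP; rewrite subr_eq0 => /eqP ->.
rewrite coefM big_mkord; apply: eq_bigr => m _.
by rewrite !coef_poly ltn_ord (leq_ltn_trans (leq_subr _ _) nL).
Qed.

(** * Symmetries and initial value of the coefficients *)

(** The i-th entry (from 0) of a strictly increasing sequence above a is at
least a + i + 1. *)
Lemma path_ltn_sum (a : nat) (s : seq nat) :
  path ltn a s -> (\sum_(0 <= i < size s) (a + i).+1 <= sumn s)%N.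
Proof.
elim: s a => [|x s IHs] a /=; first by rewrite big_geq.
move=> /andP[ax /IHs xs]; rewrite big_nat_recl // addn0 leq_add //.
apply: leq_trans xs; apply: leq_sum => i _.
by rewrite addnS -addSn ltnS leq_add2r.
Qed.

(** The entries are at least 1, 2, ..., l, so that sum k >= l(l+1)/2 and the
truncated subtraction in [kappa] is exact. *)
Lemma kappaE (k : seq nat) : (forall j, j \in k -> (0 < j)%N) -> sorted ltn k ->
  sumn k = (kappa k + 'C((size k).+1, 2))%N.
Proof.
move=> k0 ks.
have TE : 'C((size k).+1, 2) = ((size k * (size k).+1) %/ 2)%N.
  by rewrite bin2 divn2 mulnC.
have kp : path ltn 0 k.
  by case: k k0 ks {TE} => //= x s k0 ->; rewrite k0 ?mem_head.
rewrite /kappa -TE subnK // -bin2_sum big_nat_recl //= add0n.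
exact: path_ltn_sum kp.
Qed.

(** The parity of the Wronskian is sum k + n + l(l+1)/2, which differs from
kappa + n by the even number l(l+1). *)
Lemma hermite_wr_rcons_opp (R : realType) (k : seq nat) (n : nat) (x : R[i]) :
  (forall j, j \in k -> (0 < j)%N) -> sorted ltn k ->
  (hermite_wr R (rcons k n)).[- x] =
    (-1) ^+ (kappa k + n) * (hermite_wr R (rcons k n)).[x].
Proof.
move=> k0 ks; rewrite (has_parity_horner _ (hermite_wr_parity R _)).
rewrite sumn_rcons (kappaE k0 ks) size_rcons (addnAC (kappa k)) -addnA.
by rewrite exprD addnn -mul2n mulnC exprM sqrr_sign mulr1.
Qed.

Lemma mehler_coef0 (R : realType) (x y : R[i]) : mehler_coef 0 x y = 1.
Proof. by rewrite /mehler_coef hermiteC0 !hornerC expr0 fact0 !mulr1 divr1. Qed.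

Lemma mehler_coefC (R : realType) (n : nat) (x y : R[i]) :
  mehler_coef n x y = mehler_coef n y x.
Proof. by rewrite /mehler_coef [_.[x] * _]mulrC. Qed.

Lemma exc_coefC (R : realType) (k : seq nat) (n : nat) (x y : R[i]) :
  exc_coef k n x y = exc_coef k n y x.
Proof. by rewrite /exc_coef [_.[x] * _]mulrC. Qed.

Lemma mehler_coef_opp (R : realType) (n : nat) (x y : R[i]) :
  mehler_coef n (- x) y = (-1) ^+ n * mehler_coef n x y.
Proof.
by rewrite /mehler_coef (has_parity_horner _ (hermiteC_parity R n)) !mulrA.
Qed.

Lemma exc_coef_opp (R : realType) (k : seq nat) (n : nat) (x y : R[i]) :
  (forall j, j \in k -> (0 < j)%N) -> sorted ltn k ->
  exc_coef k n (- x) y = (-1) ^+ (kappa k + n) * exc_coef k n x y.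
Proof. by move=> k0 ks; rewrite /exc_coef hermite_wr_rcons_opp // !mulrA. Qed.

Lemma prodr_scale (F : comPzSemiRingType) (T : Type) (s : seq T) (c : F) (f : T -> F) :
  \prod_(j <- s) (c * f j) = c ^+ size s * \prod_(j <- s) f j.
Proof. by rewrite big_split big_const_seq count_predT -Monoid.iteropE. Qed.

(** Each of the two Wronskians contributes (-1)^l prod_j 2 k_j, and the
denominator is 2^l prod_j (- k_j). *)
Lemma exc_coef0 (R : realType) (k : seq nat) (x y : R[i]) :
  (forall j, j \in k -> (0 < j)%N) ->
  exc_coef k 0 x y =
    (- 2%:R) ^+ size k * (\prod_(j <- k) j%:R)
      * (hermite_wr R [seq j.-1 | j <- k]).[x]
      * (hermite_wr R [seq j.-1 | j <- k]).[y].
Proof.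
move=> k0; rewrite /exc_coef hermite_wr_rcons0.
set w := hermite_wr _ _.
have sE z : ((-1) ^+ size k * (\prod_(j <- k) (2 * j)%:R) * w).[z] =
    (- 2%:R) ^+ size k * (\prod_(j <- k) j%:R) * w.[z] :> R[i].
  rewrite -(@rmorphN1 _ _ (@polyC R[i])) -rmorphXn.
  rewrite (eq_bigr (fun j => (2%:R * j%:R)%:P)) => [|j _]; last by rewrite -natrM rmorph_nat.
  rewrite -rmorph_prod -mulrA !hornerCM prodr_scale.
  by rewrite -[in RHS]mulN1r exprMn !mulrA.
rewrite !sE fact0 add0n mulr1.
have -> : \prod_(j <- k) (0%:R - j%:R) = (-1) ^+ size k * \prod_(j <- k) j%:R :> R[i].
  rewrite (eq_bigr (fun j => -1 * j%:R)) => [|j _]; last by rewrite sub0r mulN1r.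
  exact: prodr_scale.
have : \prod_(j <- k) j%:R != 0 :> R[i].
  rewrite big_seq; elim/big_ind: _ => [|a b a0 b0|j jk]; first exact: oner_neq0.
    by rewrite mulf_neq0.
  by rewrite pnatr_eq0 -lt0n k0.
set p := \prod_(j <- k) _ => p0.
have s0 : (-1) ^+ size k != 0 :> R[i] by rewrite signr_eq0.
have t0 : 2%:R ^+ size k != 0 :> R[i] by rewrite expf_neq0 // pnatr_eq0.
rewrite -mulN1r exprMn; move: s0 t0; move: ((-1) ^+ _) (2%:R ^+ _) => s t s0 t0.
by field; rewrite s0 t0 p0.
Qed.

Theorem proposition1 (R : realType) (l : nat) (k : l.-tuple nat)
    (Q : nat -> {poly {poly R[i]}})
    (l_gt0 : (0 < l)%N)
    (k_gt0 : forall j : nat, j \in k -> (0 < j)%N)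
    (k_incr : sorted ltn k)
    (QE : forall z x y : R[i], `|z| < 1 ->
       exc_mehler k z x y =
         mehler z x y * \sum_(0 <= n < (last 0%N k).+2) z ^+ n * (Q n).[x, y]) :
  (forall (n : nat) (x y : R[i]), (n <= (last 0%N k).+1)%N ->
     [/\ (Q n).[x, y] = (Q n).[y, x],
         (Q n).[y, x] = (Q n).[- x, - y] &
         (Q n).[- x, - y] = (-1) ^+ (kappa k + n) * (Q n).[- x, y]])
  /\
  (forall x y : R[i],
     (Q 0%N).[x, y] =
       (- 2%:R) ^+ l * (\prod_(j <- k) j%:R)
         * (hermite_wr R [seq j.-1 | j <- k]).[x]
         * (hermite_wr R [seq j.-1 | j <- k]).[y])
  /\
  (forall (n : nat) (x y : R[i]), (0 < n <= (last 0%N k).+1)%N ->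
     (Q n).[x, y] =
       (if n \in k then 0 else exc_coef k n x y)
         - \sum_(1 <= m < n.+1) mehler_coef m x y * (Q (n - m)%N).[x, y]).
Proof.
pose b n x y : R[i] := if n \in k then 0 else exc_coef k n x y.
have rec n x y : (n <= (last 0%N k).+1)%N ->
    (Q n).[x, y] =
      b n x y - \sum_(1 <= m < n.+1) mehler_coef m x y * (Q (n - m)%N).[x, y].
  move=> nk.
  have -> : b n x y =
      \sum_(0 <= m < n.+1) mehler_coef m x y * (Q (n - m)%N).[x, y].
    apply: (pseries_mul_coef (L := (last 0%N k).+2) (q := fun m => (Q m).[x, y])
      (mehler_coef_growth x y) (exc_coef_growth k x y) _ nk) => z z1.
    rewrite -QE //; congr (limn (series _)); apply/funext => m.
    by case: ifP; rewrite ?mulr0.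
  by rewrite big_ltn // mehler_coef0 mul1r subn0 addrK.
have Qsym n x y : (n <= (last 0%N k).+1)%N -> (Q n).[x, y] = (Q n).[y, x].
  elim/ltn_ind: n => n IHn nk; rewrite !rec // /b exc_coefC; congr (_ - _).
  apply: eq_big_nat => m /andP[m0 mn]; rewrite mehler_coefC IHn ?ltn_subrL ?m0 //.
    exact: leq_trans m0 mn.
  by rewrite (leq_trans (leq_subr _ _) nk).
have Qopp n x y : (n <= (last 0%N k).+1)%N ->
    (Q n).[- x, y] = (-1) ^+ (kappa k + n) * (Q n).[x, y].
  elim/ltn_ind: n => n IHn nk; rewrite !rec // mulrBr; congr (_ - _).
    by rewrite /b; case: ifP => _; rewrite ?mulr0 ?exc_coef_opp.
  rewrite mulr_sumr; apply: eq_big_nat => m /andP[m0 mn].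
  rewrite mehler_coef_opp IHn ?ltn_subrL ?m0 ?(leq_trans m0 mn) //; last first.
    by rewrite (leq_trans (leq_subr _ _) nk).
  rewrite mulrACA -exprD; congr (_ ^+ _ * _).
  by rewrite addnCA subnKC.
split; last split.
- move=> n x y nk.
  have oppyE : (Q n).[- x, - y] = (-1) ^+ (kappa k + n) * (Q n).[- x, y].
    by rewrite Qsym // Qopp // [in RHS]Qsym.
  split=> //; first exact: Qsym.
  by rewrite oppyE Qopp // mulrA -exprD -signr_odd oddD addbb mul1r Qsym.
- move=> x y; rewrite rec // big_geq // subr0 /b ifN ?exc_coef0 ?size_tuple //.
  by apply/negP => /k_gt0.
- by move=> n x y /andP[_ nk]; exact: rec.
Qed.
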